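(* There are infinitely many pairwise non-isomorphic finite connected cubic (3-regular) bipartite graphs that have no adjacency eigenvalues in the open interval $(-1,1)$.
   Context: Eigenvalues of a finite graph are the eigenvalues of its adjacency matrix. *)

(* Defs.v *)
From mathcomp Require Import all_boot all_order all_algebra.
From mathcomp Require Import reals.

Set Implicit Arguments.
Unset Strict Implicit.
Unset Printing Implicit Defensive.

Import Order.TTheory GRing.Theory Num.Theory.
Local Open Scope ring_scope.

Record sgraph := SGraph {
  vertex :> finType;
  adj : rel vertex;
  adj_sym : symmetric adj;
  adj_irrefl : irreflexive adj
}.

Definition isomorphic (G H : sgraph) : Prop :=
  exists f : G -> H, bijective f /\ forall x y, adj (f x) (f y) = adj x y.

Definition neighbours (G : sgraph) (x : G) : {set G} := [set y | adj x y].

Definition regular (k : nat) (G : sgraph) : Prop :=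
  forall x : G, #|neighbours x| = k.

Definition cubic (G : sgraph) : Prop := regular 3 G.

(* The graph with no vertices is not connected. *)
Definition connected (G : sgraph) : Prop :=
  (0 < #|G|)%N /\ forall x y : G, connect (@adj G) x y.

Definition bipartite (G : sgraph) : Prop :=
  exists A : {set G}, forall x y : G, adj x y -> (x \in A) != (y \in A).

Definition adjacency_matrix (R : realType) (G : sgraph) : 'M[R]_#|G| :=
  \matrix_(i, j) (adj (enum_val i) (enum_val j))%:R.

Definition graph_eigenvalue (R : realType) (G : sgraph) (a : R) : Prop :=
  eigenvalue (adjacency_matrix R G) a.

(* Main.v *)
Require Import Defs.
From mathcomp Require Import all_boot all_order all_algebra.
From mathcomp Require Import reals.
From mathcomp Require Import ring lra.

Set Implicit Arguments.
Unset Strict Implicit.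
Unset Printing Implicit Defensive.

Import Order.TTheory GRing.Theory Num.Theory.
Local Open Scope ring_scope.

(** The graph on [4 n] vertices has biadjacency matrix [C (x) I + I (x) P], where
    [C = 1 + S] with [S] the cyclic shift of order [n], and [P] swaps two copies
    of [Z/n].  On vectors antisymmetric under the swap this matrix is [S], which
    is orthogonal, so the eigenvalues there are [1] and [-1].  On symmetric
    vectors it is [2 + S], which is invertible with inverse of sup-norm at most
    [1], so the eigenvalues [a] there satisfy [1 <= `|a|]. *)

Section Necklace.
Variable n : nat.

(* (side of the bipartition, copy, position in Z/(n+2)) *)
Definition necklace_vertex : finType := (bool * bool * 'I_n.+2)%type.

(** The direction depends on the side so that an edge is retraced by the inverse shift, which makes
    adjacency symmetric. *)
Definition necklace_step (s : bool) (i : 'I_n.+2) : 'I_n.+2 :=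
  if s then i - 1 else i + 1.

Definition necklace_nbrs (x : necklace_vertex) : seq necklace_vertex :=
  let: (s, c, i) := x in
  [:: (~~ s, c, i); (~~ s, c, necklace_step s i); (~~ s, ~~ c, i)].

Definition necklace_adj : rel necklace_vertex :=
  fun x y => y \in necklace_nbrs x.

Lemma necklace_stepK (s : bool) : cancel (necklace_step s) (necklace_step (~~ s)).
Proof. by case: s => i; rewrite /necklace_step /= ?addrK ?subrK. Qed.

(** The cycle has order at least 2, so [1 != 0]; this keeps the two neighbours in the same copy
    distinct. *)
Lemma necklace_step_neq (s : bool) (i : 'I_n.+2) : (i == necklace_step s i) = false.
Proof.
case: s; rewrite /necklace_step eq_sym -subr_eq0 addrC addKr ?oppr_eq0 //.
Qed.

Lemma necklace_adj_sym : symmetric necklace_adj.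
Proof.
have adjW x y : necklace_adj x y -> necklace_adj y x.
  case: x => [[s c] i]; rewrite /necklace_adj !inE.
  case/or3P => /eqP -> /=; rewrite !inE !negbK ?necklace_stepK eqxx ?orbT //.
by move=> x y; apply/idP/idP; apply: adjW.
Qed.

Lemma necklace_adj_side (x y : necklace_vertex) :
  necklace_adj x y -> y.1.1 = ~~ x.1.1.
Proof.
by case: x => [[s c] i]; rewrite /necklace_adj !inE => /or3P[] /eqP ->.
Qed.

Lemma necklace_adj_irrefl : irreflexive necklace_adj.
Proof. by move=> x; apply/negP => /necklace_adj_side; case: x.1.1. Qed.

Definition necklace : sgraph := SGraph necklace_adj_sym necklace_adj_irrefl.

Lemma card_necklace : #|necklace| = (4 * n.+2)%N.
Proof. by rewrite !card_prod !card_bool card_ord. Qed.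

Lemma necklace_nbrs_uniq (x : necklace_vertex) : uniq (necklace_nbrs x).
Proof.
case: x => [[s c] i]; rewrite /= !inE !xpair_eqE !eqxx necklace_step_neq /=.
by case: c; case: s.
Qed.

Lemma necklace_cubic : cubic necklace.
Proof.
move=> x; rewrite cardsE.
have /card_uniqP := necklace_nbrs_uniq x.
by rewrite -(@eq_card _ (mem (necklace_nbrs x))) // => ->; case: x => [[]].
Qed.

Lemma necklace_bipartite : bipartite necklace.
Proof.
exists [set x : necklace_vertex | x.1.1] => x y /necklace_adj_side.
by rewrite !inE => ->; case: x.1.1.
Qed.

Lemma necklace_connected : connected necklace.
Proof.
split; first by rewrite card_necklace.
pose o : necklace := (false, false, 0).
have csym : connect_sym (@adj necklace) by apply: sym_connect_sym; apply: adj_sym.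
have side c i : connect (@adj necklace) (false, c, i) (true, c, i).
  by apply: connect1; rewrite /= /necklace_adj !inE eqxx.
have turn i : connect (@adj necklace) (false, false, i) (true, true, i).
  by apply: connect1; rewrite /= /necklace_adj !inE eqxx !orbT.
have next i : connect (@adj necklace) (false, false, i) (true, false, i + 1).
  by apply: connect1; rewrite /= /necklace_adj !inE eqxx !orbT.
have base i : connect (@adj necklace) o (false, false, i).
  (* Each position is a multiple of [1]; one more unit costs a [next] edge and a [side] edge
     back. *)
  rewrite -[i]natr_Zp; elim: (val i) => [|k IHk]; first exact: connect0.
  apply: connect_trans IHk _; apply: connect_trans (next _) _.
  by rewrite csym -natr1; apply: side.
have from_o x : connect (@adj necklace) o x.
  case: x => [[[] []] i].
  - exact: connect_trans (base i) (turn i).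
  - exact: connect_trans (base i) (side _ i).
  - apply: connect_trans (base i) _; apply: connect_trans (turn i) _.
    by rewrite csym; apply: side.
  - exact: base.
by move=> x y; apply: connect_trans (from_o y); rewrite csym.
Qed.

End Necklace.

(** An eigenvector is a row vector, so the product sums over the first index of the matrix; symmetry
    of [adj] turns this into a sum over neighbours. *)
Lemma graph_eigenvalue_fun (R : realType) (G : sgraph) (a : R) :
  graph_eigenvalue G a ->
  exists2 f : G -> R, (exists x, f x != 0) &
    forall x, \sum_(y | adj x y) f y = a * f x.
Proof.
case/eigenvalueP => v vA v_neq0; exists (fun x => v 0 (enum_rank x)).
  case/rV0Pn: v_neq0 => j vj; exists (enum_val j).
  by rewrite enum_valK.
move=> x; have /rowP/(_ (enum_rank x)) := vA.
rewrite !mxE => <-.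
rewrite (reindex (@enum_rank G)) /=; last first.
  by apply: onW_bij; apply: enum_rank_bij.
rewrite big_mkcond; apply: eq_bigr => y _.
by rewrite mxE !enum_rankK adj_sym; case: ifP; rewrite ?mulr1 ?mulr0.
Qed.

Lemma necklace_sum (R : realType) (n : nat) (f : necklace n -> R) s c i :
  \sum_(y | adj ((s, c, i) : necklace n) y) f y =
  f (~~ s, c, i) + f (~~ s, c, necklace_step s i) + f (~~ s, ~~ c, i).
Proof.
rewrite -(big_uniq _ (necklace_nbrs_uniq (s, c, i))) /=.
by rewrite !big_cons big_nil addr0 addrA.
Qed.

Lemma necklace_eigenvalue (R : realType) (n : nat) (a : R) :
  graph_eigenvalue (necklace n) a -> ~ (-1 < a < 1).
Proof.
case/graph_eigenvalue_fun => f [x0 fx0] fE a_lt1.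
have fS s c i : f (~~ s, c, i) + f (~~ s, c, necklace_step s i) +
    f (~~ s, ~~ c, i) = a * f (s, c, i) by rewrite -fE necklace_sum.
(* Subtracting the equations of the two copies cancels the terms at position [i] and leaves only the
   shift. *)
pose d s i := f (s, false, i) - f (s, true, i).
have dS s i : d (~~ s) (necklace_step s i) = a * d s i.
  by rewrite /d mulrBr -!fS /=; ring.
have d0 s i : d s i = 0.
  (* A shift and its inverse return to the start, so two uses of [dS] multiply [d s i] by
     [a ^+ 2]. *)
  have : (1 - a ^+ 2) * d s i = 0.
    have := dS (~~ s) (necklace_step s i).
    by rewrite negbK necklace_stepK dS mulrBl mul1r => {1}->; ring.
  move/eqP; rewrite mulf_eq0 => /orP[/eqP a2|/eqP //].
  by nra.
have f_sym s c i : f (s, ~~ c, i) = f (s, c, i).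
  by have := d0 s i; rewrite /d; case: c => /=; lra.
have [x _ x_max] := @arg_maxP _ _ _ x0 predT (fun x => `|f x|) isT.
have fx_gt0 : 0 < `|f x|.
  by apply: lt_le_trans (x_max x0 isT); rewrite normr_gt0.
case: x => [[s c] i] in x_max fx_gt0 *.
(* By symmetry the maximal value [u] occurs twice in the equation at this neighbour:
   [2 * u + v = a * w]. Since [v] and [w] are no larger in absolute value and [u] is nonzero,
   [|a| < 1] is contradicted. *)
have := fS (~~ s) c i; rewrite negbK f_sym.
have := x_max (s, c, necklace_step (~~ s) i) isT.
have := x_max (~~ s, c, i) isT.
move: fx_gt0; set u := f (s, c, i); set v := f (s, _, _); set w := f _ => u_gt0.
move=> /= w_le v_le uvE.
have a_norm : `|a| < 1 by rewrite ltr_norml.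
have : 2 * `|u| <= `|a| * `|w| + `|v|.
  have -> : 2 * `|u| = `|a * w - v|.
    by rewrite -uvE -[2]ger0_norm // -normrM; congr (`|_|); ring.
  by rewrite -normrM; apply: ler_normB.
have aw : `|a| * `|w| <= `|a| * `|u| by apply: ler_wpM2l.
have : `|a| * `|u| < `|u| by rewrite gtr_pMl.
by lra.
Qed.

Theorem theorem3 (R : realType) :
  exists G : nat -> sgraph,
    (forall i j : nat, i <> j -> ~ isomorphic (G i) (G j)) /\
    (forall i : nat,
       [/\ connected (G i), cubic (G i), bipartite (G i) &
           forall a : R, graph_eigenvalue (G i) a -> ~ (-1 < a < 1)]).
Proof.
exists necklace; split=> [i j neq_ij [f [/bij_eq_card]]|i].
  by rewrite !card_necklace => /eqP; rewrite eqn_pmul2l // => /eqP[].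
split.
- exact: necklace_connected.
- exact: necklace_cubic.
- exact: necklace_bipartite.
- exact: necklace_eigenvalue.
Qed.
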